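(* For every integer $r\ge 2$ there is $C = C(r)>0$ such that the following holds. Let $G$ be an $n$-vertex graph and suppose either that $G$ is $3$-connected, or that $G$ is $2$-connected and $\iota(G)\ge C n^{-1/2}$. Then $\mathcal{D}_r(G,\mathcal{T}_n)\ge \left\lfloor\frac{\iota(G)\cdot n}{C}\right\rfloor$.
   Context: Graphs are finite and simple; ''$k$-connected'' means $k$-vertex-connected. Spanning-tree discrepancy: for a connected $n$-vertex graph $G$, an $r$-colouring $f:E(G)\to[r]$ of its edges, and a spanning tree $T$ of $G$ (which has $n-1$ edges), put $D_f(T) := r\cdot\left(\max_{1\le i\le r}|f^{-1}(i)\cap E(T)| - \frac{n-1}{r}\right)$. The $r$-colour spanning-tree discrepancy of $G$ is $\mathcal{D}_r(G,\mathcal{T}_n) := \min_{f:E(G)\to[r]}\ \max_{T} D_f(T)$, where the maximum is over all spanning trees $T$ of $G$. Vertex isoperimetric constant: $\iota(G)$ is the minimum of $|N(U)|/|U|$ over all $U\subseteq V(G)$ with $0<|U|\le |V(G)|/2$, where $N(U)$ is the external neighbourhood of $U$, i.e. the set of vertices outside $U$ that have a neighbour in $U$. *)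

(* Defs.v *)
From HB Require Import structures.
From mathcomp Require Import all_boot all_order all_algebra.
From mathcomp Require Import classical_sets reals.

Set Implicit Arguments.
Unset Strict Implicit.
Unset Printing Implicit Defensive.

Import Order.TTheory GRing.Theory Num.Theory.

Local Open Scope ring_scope.

(* The minima and maxima of real quantities below are taken over finite sets
   and are written with [inf] and [sup]; these are attained as soon as the set
   is nonempty ([inf] and [sup] of the empty set are 0). *)

Structure sgraph := SGraph {
  vertex :> finType;
  adj : rel vertex;
  adj_sym : symmetric adj;
  adj_irrefl : irreflexive adj }.

Definition edge_set (G : sgraph) : {set {set G}} :=
  [set [set x; y]%SET | x in G, y in G & adj x y]%SET.

Definition edge (G : sgraph) : finType := {d : {set G} | d \in edge_set G}.

Definition k_connected (k : nat) (G : sgraph) : Prop :=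
  (k < #|G|)%N /\
  forall X : {set G}, (#|X| < k)%N ->
    forall x y : G, x \notin X -> y \notin X ->
      connect [rel u v | [&& adj u v, u \notin X & v \notin X]] x y.

Definition sub_adj (G : sgraph) (S : {set edge G}) : rel G :=
  [rel x y | [exists d in S, val d == [set x; y]%SET]].

Definition spanning_tree (G : sgraph) (S : {set edge G}) : Prop :=
  (forall x y : G, connect (sub_adj S) x y) /\
  (forall c : seq G, ucycle (sub_adj S) c -> (size c < 3)%N).

Definition tree_discrepancy (R : realType) (r : nat) (G : sgraph)
    (f : {ffun edge G -> 'I_r}) (S : {set edge G}) : R :=
  r%:R * ((\max_(i < r) #|(f @^-1: [set i]%SET) :&: S|)%N%:R
          - (#|G|%:R - 1) / r%:R).

Definition discrepancy (R : realType) (r : nat) (G : sgraph) : R :=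
  inf [set sup [set tree_discrepancy R f S | S in @spanning_tree G]
      | f in [set: {ffun edge G -> 'I_r}]]%classic.

Definition ext_nbhd (G : sgraph) (U : {set G}) : {set G} :=
  [set v in ~: U | [exists u in U, adj u v]]%SET.

Definition isoperimetric (R : realType) (G : sgraph) : R :=
  inf [set #|ext_nbhd U|%:R / #|U|%:R
      | U in [set U : {set G} | (0 < #|U|)%N /\ (2 * #|U| <= #|G|)%N]]%classic.

(* Main.v *)
(** Take [C = 16 r].  Call [s] the claimed bound,
    [n] the number of vertices, and suppose that for some colouring every
    spanning tree has discrepancy below [s].  Some spanning tree contains a
    spanning forest of any given colour class, so every colour class has rank
    less than [(n - 1 + s) / r].  Split the edges into one colour and all the
    others: the two classes have [c1] and [c2] components with
    [n + 1 - c1 - c2 < s], and no component is too large.  The nontrivial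
    components of both classes, linked by the vertices they share, form a
    bipartite multigraph of cyclomatic number [n + 1 - c1 - c2], whose degrees
    are at least 2 because [G] is 2-connected; the total excess of the degrees
    over 2 is therefore [2 (n - c1 - c2)].  Adding components one at a time to a
    connected family until it covers at least [n / (2 r)] vertices gives a vertex
    set whose inner boundary has at most [2 s - 2] vertices.  The set without
    its boundary, and its complement, both have at least [n / (8 r)] vertices,
    so the smaller one contradicts the definition of [iota]. *)
Require Import Defs.
From HB Require Import structures.
From mathcomp Require Import all_boot all_order all_algebra.
From mathcomp Require Import classical_sets reals.
From mathcomp Require Import boolp zify fintype finset fingraph.

Set Implicit Arguments.
Unset Strict Implicit.
Unset Printing Implicit Defensive.

Import Order.TTheory GRing.Theory Num.Theory.

Local Open Scope set_scope.
Local Open Scope nat_scope.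

(** * Components and cycles when an edge is added or removed *)

Lemma connect_add_edge (T : finType) (e e' : rel T) (x y : T) :
  symmetric e ->
  (forall u v, e' u v -> [\/ e u v, u = x /\ v = y | u = y /\ v = x]) ->
  forall u v, connect e' u v ->
    [\/ connect e u v, connect e u x /\ connect e y v
      | connect e u y /\ connect e x v].
Proof.
move=> /sym_connect_sym symC sub_e u v /connectP[p + ->].
elim: p u => [|w p IHp] u /=; first by move=> _; constructor 1.
case/andP=> /sub_e euw /IHp {IHp}.
case: euw => [/connect1 euw | [-> ->] | [-> ->]] [cwv | [cwx cyv] | [cwy cxv]].
- by constructor 1; apply: connect_trans cwv.
- by constructor 2; split=> //; apply: connect_trans cwx.
- by constructor 3; split=> //; apply: connect_trans cwy.
- by constructor 2.
- by constructor 2.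
- by constructor 1.
- by constructor 3.
- by constructor 1.
- by constructor 3.
Qed.

(** [root e'] is injective on the [e]-roots other than that of [x]: the extra edge can only merge
    the component of [x] with that of [y]. *)
Lemma card_roots_add_edge (T : finType) (e e' : rel T) (x y : T) :
  symmetric e -> symmetric e' ->
  (forall u v, e' u v -> [\/ e u v, u = x /\ v = y | u = y /\ v = x]) ->
  #|roots e| <= #|roots e'|.+1.
Proof.
move=> syme /sym_connect_sym symC' sub_e; have symC := sym_connect_sym syme.
rewrite (cardD1x (roots_root symC x)) addnC addn1 ltnS.
rewrite -[X in X <= _](card_in_image (f := root e')).
  by apply/subset_leq_card/subsetP=> v /imageP[u _ ->]; apply: roots_root.
have far z : z \in [pred z | roots e z & z != root e x] ->
    root e z = z /\ ~~ connect e z x.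
  rewrite !inE => /andP[/eqP rz zx]; split=> //.
  by rewrite -root_connect // rz.
move=> u v /far[ru uNx] /far[rv vNx] /eqP; rewrite root_connect //.
move/(connect_add_edge syme sub_e)=> [cuv | [cux _] | [_ cxv]].
- by rewrite -ru -rv; apply/rootP.
- by rewrite cux in uNx.
- by rewrite symC cxv in vNx.
Qed.

(** The rest of the cycle leads from [next c x] back to [x]; having at least three distinct
    vertices, it does not use the edge from [x] to [next c x] again. *)
Lemma ucycle_bypass (T : finType) (e : rel T) (c : seq T) (x : T) :
  ucycle e c -> 2 < size c -> x \in c ->
  connect [rel u v | e u v && ([set u; v] != [set x; next c x])] (next c x) x.
Proof.
move=> ucc szc xc.
have [i s rot_c] := rot_to xc.
rewrite -(next_rot i) ?(ucycle_uniq ucc) //.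
move: szc ucc; rewrite -(rot_ucycle i) -(size_rot i) rot_c.
case: s {rot_c} => [|y [|z q]] //= _ /andP[].
rewrite /cycle eqxx /= rcons_path !inE !negb_or.
move=> /and4P[exy eyz pzq elast] /and3P[/and3P[xy xz xq] /andP[yz yq] /andP[zq _]].
set e' := (X in connect X).
have pyzq : path e' y (z :: q).
  apply: (@sub_in_path _ (predC1 x) e) => [u v||]; last by rewrite /= eyz.
    rewrite !inE => ux vx euv; rewrite /e' /= euv; apply/eqP=> /setP/(_ x).
    by rewrite !inE eqxx !(eq_sym x) (negPf ux) (negPf vx).
  rewrite /= !(eq_sym _ x) xy xz; apply/allP=> w wq /=.
  by apply: contraNneq xq => <-.
apply/connectP; exists (rcons (z :: q) x); last by rewrite last_rcons.
rewrite rcons_path pyzq /e' /= elast.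
have: last z q != y.
  have:= mem_last z q; rewrite inE => /predU1P[-> | lq]; first by rewrite eq_sym.
  by apply: contraNneq yq => <-.
have: last z q != x.
  have:= mem_last z q; rewrite inE => /predU1P[-> | lq]; first by rewrite eq_sym.
  by apply: contraNneq xq => <-.
move=> lx ly; apply/eqP=> /setP/(_ (last z q)).
by rewrite !inE eqxx (negPf lx) (negPf ly).
Qed.

(** * Ranks of edge sets and spanning trees *)

Lemma sub_adj_sym (G : sgraph) (S : {set edge G}) : symmetric (sub_adj S).
Proof. by move=> x y /=; apply: eq_existsb => d; rewrite setUC. Qed.

Lemma sub_adjP (G : sgraph) (S : {set edge G}) (x y : G) :
  reflect (exists2 d, d \in S & val d = [set x; y]) (sub_adj S x y).
Proof.
apply: (iffP existsP) => [[d /andP[dS /eqP]] | [d dS dxy]]; first by exists d.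
by exists d; rewrite dS dxy /=.
Qed.

Lemma set2_inj (T : finType) (x y u v : T) : [set u; v] = [set x; y] ->
  (u = x /\ v = y) \/ (u = y /\ v = x).
Proof.
move=> /setP eq_mem; move: (eq_mem u) (eq_mem v) (eq_mem x) (eq_mem y).
rewrite !inE !eqxx ?orbT /= (eq_sym x) (eq_sym y) (eq_sym x) (eq_sym y).
by do 4?[case: eqP => /=]; auto; move=> *; congruence.
Qed.

Lemma sub_adj_adj (G : sgraph) (S : {set edge G}) (x y : G) :
  sub_adj S x y -> adj x y.
Proof.
case/sub_adjP=> d _ dxy; have /imset2P[u v _] := valP d.
rewrite !inE dxy /= => uv /set2_inj[] [-> ->]; by rewrite // adj_sym.
Qed.

Lemma adj_edge (G : sgraph) (x y : G) :
  adj x y -> exists d : edge G, val d = [set x; y].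
Proof.
move=> xy; have xyE : [set x; y] \in edge_set G.
  by apply/imset2P; exists x y; rewrite ?inE.
by exists (exist (fun D => D \in edge_set G) _ xyE).
Qed.

Lemma sub_adjS (G : sgraph) (S S' : {set edge G}) : S \subset S' ->
  forall x y : G, connect (sub_adj S) x y -> connect (sub_adj S') x y.
Proof.
move=> /subsetP sSS'; apply: connect_sub => x y /sub_adjP[d /sSS' dS' dxy].
by apply/connect1/sub_adjP; exists d.
Qed.

(** Deleting an edge creates at most one new component, and without edges every vertex is a
    component. *)
Lemma card_le_edges_comps (G : sgraph) (F : {set edge G}) :
  #|G| <= #|F| + #|roots (sub_adj F)|.
Proof.
have [m] := ubnP #|F|; elim: m F => // m IHm F; rewrite ltnS => Fm.
have [->|[d dF]] := set_0Vmem F.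
  rewrite cards0 add0n; apply/subset_leq_card/subsetP=> x _.
  have /connectP[[|y p] /= + rx] := connect_root (sub_adj set0) x.
    by rewrite unfold_in rx.
  by case/andP=> /sub_adjP[d]; rewrite inE.
have /imset2P[x y _ _ dxy] := valP d.
have FD : #|F| = #|F :\ d|.+1 by rewrite (cardsD1 d F) dF.
apply: leq_trans (IHm (F :\ d) _) _; first by rewrite -FD.
rewrite FD addSnnS leq_add2l.
apply: (@card_roots_add_edge _ _ _ x y); try exact: sub_adj_sym.
move=> u v /sub_adjP[d' d'F d'uv]; have [dd'|dd'] := eqVneq d' d.
  by move: d'uv; rewrite dd' dxy => /esym/set2_inj[];
     [constructor 2 | constructor 3].
by constructor 1; apply/sub_adjP; exists d'; rewrite // !inE dd'.
Qed.

Lemma connect_remove_edge (G : sgraph) (F : {set edge G}) (d : edge G) (x y : G) :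
  val d = [set x; y] -> connect (sub_adj (F :\ d)) x y ->
  forall u v, connect (sub_adj F) u v -> connect (sub_adj (F :\ d)) u v.
Proof.
move=> dxy cxy; apply: connect_sub => u v /sub_adjP[d' d'F d'uv].
have [dd'|dd'] := eqVneq d' d; last first.
  by apply/connect1/sub_adjP; exists d'; rewrite // !inE dd'.
move: d'uv; rewrite dd' dxy => /esym/set2_inj[] [-> ->] //.
by rewrite (sym_connect_sym (@sub_adj_sym _ _)).
Qed.

Lemma ucycle_edge_redundant (G : sgraph) (F : {set edge G}) (c : seq G) (x : G)
    (d : edge G) :
  ucycle (sub_adj F) c -> 2 < size c -> x \in c -> val d = [set x; next c x] ->
  forall u v, connect (sub_adj F) u v -> connect (sub_adj (F :\ d)) u v.
Proof.
move=> ucc szc xc dx; apply: (connect_remove_edge dx).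
rewrite (sym_connect_sym (@sub_adj_sym _ _)).
apply: connect_sub (ucycle_bypass ucc szc xc) => u v /= /andP[].
case/sub_adjP=> d' d'F d'uv uv; apply/connect1/sub_adjP; exists d' => //.
by rewrite !inE d'F andbT; apply: contraNneq uv => d'd; rewrite -d'uv d'd dx.
Qed.

(* A minimal spanning connected edge set that meets [A] in a set with the
   components of [A] is a tree: a cycle has a removable edge, chosen outside
   [A] if the cycle leaves [A]. *)
Lemma spanning_tree_extending (G : sgraph) (A : {set edge G}) :
  (forall x y : G, connect (@adj G) x y) ->
  exists2 S : {set edge G}, spanning_tree S
    & forall x y, connect (sub_adj A) x y -> connect (sub_adj (S :&: A)) x y.
Proof.
move=> connG.
pose P (S : {set edge G}) :=
  [forall x, forall y, (connect (sub_adj A) x y ==> connect (sub_adj (S :&: A)) x y)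
     && connect (sub_adj S) x y].
have PP S : reflect ((forall x y, connect (sub_adj A) x y ->
    connect (sub_adj (S :&: A)) x y) /\ forall x y, connect (sub_adj S) x y) (P S).
  apply: (iffP forallP) => [PS | [PA PS] x].
    by split=> x y; have /forallP/(_ y)/andP[/implyP] := PS x.
  by apply/forallP=> y; rewrite PS andbT; apply/implyP/PA.
have PT : P setT.
  apply/PP; split=> x y; first by rewrite setTI.
  apply: connect_sub (connG x y) => u v /adj_edge[d duv].
  by apply/connect1/sub_adjP; exists d; rewrite ?inE.
have [S minS _] := minset_exists PT.
have /PP[PA PS] := minsetp minS.
exists S; last exact: PA.
split=> // c ucc; rewrite ltnNge; apply/negP=> szc.
suff [d dS PSd] : exists2 d, d \in S & P (S :\ d).
  have := minsetinf minS PSd (subD1set _ _).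
  by move/setP/(_ d); rewrite !inE eqxx dS.
have /andP[cyc uc] := ucc.
(* On a cycle inside [S :&: A], any edge is redundant both in [S] and in [S :&: A]. *)
have [cA | ] := boolP (cycle (sub_adj (S :&: A)) c).
  case: c ucc szc {cyc} uc cA => // x c ucc szc uc cA.
  have xc : x \in x :: c by rewrite mem_head.
  have /sub_adjP[d] := next_cycle cA xc.
  rewrite inE => /andP[dS dA] dx; exists d => //; apply/PP; split=> u v.
    move/PA; rewrite setIDAC.
    have ucA : ucycle (sub_adj (S :&: A)) (x :: c) by apply/andP.
    exact: (ucycle_edge_redundant ucA szc xc dx).
  exact: (ucycle_edge_redundant ucc szc xc dx).
move=> ncA.
have [x xc nx] : exists2 x, x \in c & ~~ sub_adj (S :&: A) x (next c x).
  apply/hasP; apply: contraR ncA => /hasPn allc.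
  by apply: cycle_from_next => // x /allc; rewrite negbK.
have /sub_adjP[d dS dx] := next_cycle cyc xc.
have dA : d \notin A.
  by apply: contra nx => dA; apply/sub_adjP; exists d; rewrite // inE dS.
exists d => //; apply/PP; split=> u v.
  suff -> : (S :\ d) :&: A = S :&: A by apply: PA.
  by apply/setP=> d'; rewrite !inE; case: eqP => // ->; rewrite (negPf dA) !andbF.
exact: (ucycle_edge_redundant ucc szc xc dx).
Qed.

(** * The bipartite multigraph of two edge classes *)

Definition touched (T : finType) (e : rel T) : {set T} :=
  [set v | [exists w, e v w]].

(* The nontrivial components of two edge classes are the nodes of a bipartite
   multigraph whose edges are the shared vertices: a node is a class together
   with the root of a component of that class. *)
Definition nodes (T : finType) (e : bool -> rel T) :=
  [set p : bool * T | roots (e p.1) p.2 && (p.2 \in touched (e p.1))].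

Definition shared (T : finType) (e : bool -> rel T) : {set T} :=
  touched (e true) :&: touched (e false).

(** For a [v] without edges in class [i] this pair lies outside [nodes e]. *)
Definition node_of (T : finType) (e : bool -> rel T) (v : T) (i : bool) :=
  (i, root (e i) v).

(** The multigraph edges at the node [p]; their number is its degree. *)
Definition ports (T : finType) (e : bool -> rel T) (p : bool * T) : {set T} :=
  [set v in shared e | node_of e v p.1 == p].

(** The edge cut of [X] in the multigraph. *)
Definition frontier (T : finType) (e : bool -> rel T) (X : {set _}) : {set T} :=
  [set v in shared e | (node_of e v true \in X) (+) (node_of e v false \in X)].

Definition covered (T : finType) (e : bool -> rel T) (X : {set _}) : {set T} :=
  [set v | (node_of e v true \in X) || (node_of e v false \in X)].

Lemma touched_connect (T : finType) (e : rel T) (x y : T) :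
  symmetric e -> connect e x y -> (x \in touched e) = (y \in touched e).
Proof.
move=> syme cxy.
have half u v : connect e u v -> v \in touched e -> u \in touched e.
  case/connectP=> -[|w p] /= + ->; first by [].
  by case/andP=> euw _ _; rewrite inE; apply/existsP; exists w.
by apply/idP/idP; apply: half; rewrite // (sym_connect_sym syme).
Qed.

Lemma node_of_nodes (T : finType) (e : bool -> rel T) (v : T) (i : bool) :
  (forall i, symmetric (e i)) -> v \in touched (e i) -> node_of e v i \in nodes e.
Proof.
move=> syme tv; rewrite inE /= roots_root; last exact: sym_connect_sym.
by rewrite -(touched_connect (syme i) (connect_root _ v)).
Qed.

Lemma nodes_touched (T : finType) (e : bool -> rel T) (v : T) (i : bool) :
  (forall i, symmetric (e i)) -> node_of e v i \in nodes e -> v \in touched (e i).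
Proof.
move=> syme; rewrite inE /= => /andP[_].
by rewrite -(touched_connect (syme i) (connect_root _ v)).
Qed.

(** Adding [p] toggles exactly its ports, since the other end of a port is a node of the other
    class: the new frontier is the symmetric difference of the old one and the ports. *)
Lemma card_frontierU (T : finType) (e : bool -> rel T) (X : {set _})
    (p : bool * T) :
  p \notin X ->
  #|frontier e (p |: X)| + 2 * #|frontier e X :&: ports e p|
    <= #|frontier e X| + #|ports e p|.
Proof.
move=> pX; rewrite -cardsUI mul2n -addnn addnA leq_add2r.
rewrite -(cardsID (frontier e X :&: ports e p) (frontier e X :|: ports e p)) addnC.
apply: leq_add; first by apply/subset_leq_card/subsetP=> v; rewrite !inE => /andP[-> ->].
apply/subset_leq_card/subsetP=> v; rewrite !inE.
case: ([exists w, _ w] && _) => //=; case: p pX => -[] z zX; rewrite /node_of !xpair_eqE /=.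
  by case: eqP => [-> | _]; rewrite ?(negPf zX) /=;
    case: ((true, root (e true) v) \in X); case: ((false, root (e false) v) \in X).
by case: eqP => [-> | _]; rewrite ?(negPf zX) /= ?orbF;
  case: ((true, root (e true) v) \in X); case: ((false, root (e false) v) \in X).
Qed.

(** Handshake identity: each shared vertex is an edge with one end in each class. *)
Lemma sum_card_ports (T : finType) (e : bool -> rel T) :
  (forall i, symmetric (e i)) ->
  \sum_(p in nodes e) #|ports e p| = 2 * #|shared e|.
Proof.
move=> syme.
have cls i : \sum_(z | (i, z) \in nodes e) #|ports e (i, z)| = #|shared e|.
  rewrite -[in RHS]sum1_card.
  rewrite [RHS](partition_big (root (e i)) (fun z => (i, z) \in nodes e)) => [|v].
    apply: eq_bigr => z _; rewrite -sum1_card; apply: eq_bigl => v.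
    by rewrite !inE /node_of xpair_eqE eqxx.
  by case/setIP=> tt tf; apply: (@node_of_nodes _ e v i) => //; case: (i).
transitivity (\sum_(i : bool) \sum_(z | (i, z) \in nodes e) #|ports e (i, z)|).
  by rewrite pair_big_dep; apply: eq_big => -[].
by rewrite big_bool /= !cls addnn mul2n.
Qed.

(** Class [i] has one component per node and one per untouched vertex. No vertex is untouched by
    both classes, so the untouched ones number [#|T| - #|shared e|] in total. *)
Lemma card_nodes (T : finType) (e : bool -> rel T) :
  (forall i, symmetric (e i)) ->
  (forall v, (v \in touched (e true)) || (v \in touched (e false))) ->
  #|nodes e| + #|T| = #|roots (e true)| + #|roots (e false)| + #|shared e|.
Proof.
move=> syme tch.
have cls i : #|roots (e i)| = \sum_(z | (i, z) \in nodes e) 1 + #|~: touched (e i)|.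
  rewrite -(cardID (mem (touched (e i))) (roots (e i))).
  congr (_ + _); first by rewrite -sum1_card; apply: eq_bigl => z; rewrite !inE andbC.
  apply: eq_card => z; rewrite !inE andbC.
  case: (boolP [exists w, e i z w]); rewrite ?andbF // => nt; rewrite andbT.
  rewrite /roots; have /connectP[[|y p] /= + rx] := connect_root (e i) z.
    by rewrite rx eqxx.
  by case/andP=> eizy; case/existsP: nt; exists y.
have -> : #|nodes e| = \sum_(i : bool) \sum_(z | (i, z) \in nodes e) 1.
  by rewrite pair_big_dep -sum1_card; apply: eq_bigl => -[].
rewrite big_bool /= !cls.
have := cardsC (shared e); rewrite /shared setCI.
have -> : #|~: touched (e true) :|: ~: touched (e false)|
    = #|~: touched (e true)| + #|~: touched (e false)|.
  rewrite -cardsUI; suff -> : ~: touched (e true) :&: ~: touched (e false) = set0.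
    by rewrite cards0 addn0.
  by apply/setP=> v; rewrite -setCU in_setC in_setU tch inE.
by move=> /= <-; lia.
Qed.

(** * Growing a connected family of components *)

Definition component (T : finType) (e : bool -> rel T) (p : bool * T) : {set T} :=
  [set v | node_of e v p.1 == p].

Lemma crossing_edge (T : finType) (e : rel T) (A : {set T}) (x y : T) :
  connect e x y -> x \in A -> y \notin A ->
  exists u v, [/\ e u v, u \in A & v \notin A].
Proof.
case/connectP=> p + ->; elim: p x => [|w p IHp] x /=; first by move=> _ ->.
case/andP=> exw pw xA lA; have [wA | wA] := boolP (w \in A); first exact: (IHp w).
by exists x, w.
Qed.

(** The component of class [i] through the edge contains [v], so it is not in [X], and [u] is
    covered by the other class alone. Hence the inner boundary of the covered set lies in the
    frontier. *)
Lemma edge_out_cover (T : finType) (e : bool -> rel T) (X : {set _})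
    (i : bool) (u v : T) :
  (forall i, symmetric (e i)) -> X \subset nodes e ->
  e i u v -> u \in covered e X -> v \notin covered e X ->
  [/\ node_of e u i \notin X, node_of e u i \in nodes e & u \in frontier e X].
Proof.
move=> syme /subsetP sX euv uX vX.
have tu : u \in touched (e i) by rewrite inE; apply/existsP; exists v.
have uv : node_of e u i = node_of e v i.
  by congr (_, _); apply/(rootP (sym_connect_sym (syme i)))/connect1.
have uNX : node_of e u i \notin X.
  by apply: contra vX; rewrite uv inE; case: (i) => ->; rewrite ?orbT.
have uX' : node_of e u (~~ i) \in X.
  by move: uX uNX; rewrite inE; case: (i) => /= /orP[] // ->.
have tu' := nodes_touched syme (sX _ uX').
split=> //; first exact: node_of_nodes.
rewrite inE /shared inE; move: tu tu' uX' uNX.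
by case: (i) => /= -> -> -> /negPf ->.
Qed.

(** Connectivity gives an edge leaving the covered set; the component of that edge is the new node,
    joined to [X] through the inner end of the edge. *)
Lemma next_node (T : finType) (e : bool -> rel T) (X : {set _}) :
  (forall i, symmetric (e i)) ->
  (forall x y, connect [rel u v | e true u v || e false u v] x y) ->
  X \subset nodes e -> X != set0 -> #|covered e X| < #|T| ->
  exists p, [/\ p \in nodes e, p \notin X & 0 < #|frontier e X :&: ports e p|].
Proof.
move=> syme conn sX /set0Pn[[i z] zX] ltXT.
have zC : z \in covered e X.
  have /(subsetP sX) := zX; rewrite !inE /= => /andP[/eqP rz _].
  by move: zX; rewrite -{1}rz /node_of; case: (i) => ->; rewrite ?orbT.
have [w wC] : exists w, w \notin covered e X.
  apply/existsP; apply: contraLR ltXT => /existsPn all_in; rewrite -leqNgt -cardsT.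
  by apply/subset_leq_card/subsetP=> w _; have := all_in w; rewrite negbK.
have [u [v [uv uC vC]]] := crossing_edge (conn z w) zC wC.
have [j euv] : exists j, e j u v by case/orP: uv; [exists true | exists false].
have [uNX uN uF] := edge_out_cover syme sX euv uC vC.
exists (node_of e u j); split=> //; apply/card_gt0P; exists u.
rewrite inE uF inE eqxx andbT.
by move: uF; rewrite inE => /andP[].
Qed.

(* Adding to a connected family of nodes a node that shares a vertex with it
   raises the size of the frontier by at most the number of ports minus 2, so
   that the frontier never exceeds 2 plus the total excess. *)
Lemma grow_nodes (T : finType) (e : bool -> rel T) (m k : nat) :
  (forall i, symmetric (e i)) ->
  (forall x y, connect [rel u v | e true u v || e false u v] x y) ->
  nodes e != set0 ->
  (forall p, p \in nodes e -> 2 <= #|ports e p|) ->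
  (forall p, p \in nodes e -> #|component e p| <= k) ->
  0 < m <= #|T| ->
  exists X : {set _}, [/\ X \subset nodes e, m <= #|covered e X|, #|covered e X| < m + k
    & #|frontier e X| + 2 * #|nodes e| <= 2 * #|shared e| + 2].
Proof.
move=> syme conn /set0Pn[p0 p0N] ports2 comp_k /andP[m0 mT].
(* The frontier is at most 2 plus the excess of the ports over 2 in [X], with the subtraction moved
   across. *)
pose inv (X : {set _}) := (X \subset nodes e) &&
  (#|frontier e X| + 2 * #|X| <= 2 + \sum_(p in X) #|ports e p|).
have cover0 : covered e set0 = set0 by apply/setP=> v; rewrite !inE.
have front0 : frontier e set0 = set0 by apply/setP=> v; rewrite !inE /= andbF.
have start : inv set0 && (#|covered e set0| < m).
  by rewrite /inv sub0set cover0 front0 !cards0 m0.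
(* By maximality, one more node that keeps the invariant must bring the cover to [m]. *)
have [X maxX _] := maxset_exists (P := fun X => inv X && (#|covered e X| < m)) start.
have /andP[/andP[sX invX] ltX] := maxsetp maxX.
have [p [pN pX invpX]] : exists p, [/\ p \in nodes e, p \notin X & inv (p |: X)].
  have extend p : p \in nodes e -> p \notin X ->
      2 <= #|ports e p| ->
      (X == set0) || (0 < #|frontier e X :&: ports e p|) -> inv (p |: X).
    move=> pN pX p2 h; rewrite /inv subUset sub1set pN sX /=.
    have -> : #|p |: X| = 1 + #|X| by rewrite cardsU1 pX.
    rewrite (big_setU1 _ pX).
    (* The first node is paid for by the constant 2; every later one removes a vertex from the
       frontier ([0 < I]), which saves 2. *)
    have arith F F' I P x d : F' + 2 * I <= F + P -> F + 2 * x <= 2 + d ->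
        0 < I \/ F = 0 /\ x = 0 -> F' + 2 * (1 + x) <= 2 + (P + d) by lia.
    apply: arith (card_frontierU e pX) invX _.
    by case/orP: h => [/eqP -> | h]; [right; rewrite front0 !cards0 | left].
  have [X0 | Xn0] := eqVneq X set0.
    have p0X : p0 \notin X by rewrite X0 inE.
    by exists p0; split=> //; apply: extend; rewrite ?ports2 // X0 eqxx.
  have [p [pN pX pF]] := next_node syme conn sX Xn0 (leq_trans ltX mT).
  by exists p; split=> //; apply: extend; rewrite ?ports2 // pF orbT.
exists (p |: X); have /andP[spX invpX'] := invpX; split=> //.
- rewrite leqNgt; apply: contra pX => ltpX.
  have := maxsetsup maxX (B := p |: X); rewrite invpX ltpX subsetUr => <- //.
  by rewrite !inE eqxx.
- have sub : covered e (p |: X) \subset covered e X :|: component e p.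
    apply/subsetP=> v; rewrite !inE.
    case: p {pN pX invpX spX invpX'} => -[] z; rewrite /node_of !xpair_eqE /=;
      case: ((true, root (e true) v) \in X);
      case: ((false, root (e false) v) \in X); rewrite ?orbT ?orbF //= => ->.
  apply: leq_ltn_trans (subset_leq_card sub) _.
  apply: leq_ltn_trans (leq_card_setU _ _) _.
  by rewrite -addSn; apply: leq_add => //; apply: comp_k.
rewrite -(sum_card_ports syme).
rewrite [X in _ <= X + _](bigID (mem (p |: X))) /=.
have -> : \sum_(q in nodes e | q \in p |: X) #|ports e q|
    = \sum_(q in p |: X) #|ports e q|.
  apply: eq_bigl => q; have [/(subsetP spX) -> //|] := boolP (q \in p |: X).
  by rewrite andbF.
(* Nodes outside the family have nonnegative excess, so the total excess is at least that of the
   family. *)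
have rest : 2 * #|nodes e :\: (p |: X)|
    <= \sum_(q in nodes e | q \notin p |: X) #|ports e q|.
  rewrite mulnC -sum_nat_const (eq_bigl (fun q => (q \in nodes e) && (q \notin p |: X))).
    by apply: leq_sum => q /andP[/ports2].
  by move=> q; rewrite [LHS]inE andbC.
have split_nodes : #|p |: X| + #|nodes e :\: (p |: X)| = #|nodes e|.
  by rewrite -(cardsID (p |: X) (nodes e)) (setIidPr spX).
have arith F x y z d d' : F + 2 * x <= 2 + d -> 2 * y <= d' -> x + y = z ->
    F + 2 * z <= d + d' + 2 by lia.
exact: arith invpX' rest split_nodes.
Qed.

(** * Separators from two edge classes *)

(** Every root but that of the component itself lies outside the component. *)
Lemma card_component (T : finType) (e : bool -> rel T) (p : bool * T) :
  p \in nodes e -> #|component e p| + #|roots (e p.1)| <= #|T| + 1.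
Proof.
case: p => i x; rewrite inE => /andP[/eqP /= rx _].
rewrite -(cardsC (component e (i, x))) -addnA leq_add2l.
apply: (@leq_trans #|x |: ~: component e (i, x)|); last first.
  by rewrite cardsU1 addnC leq_add2l leq_b1.
apply/subset_leq_card/subsetP=> z; rewrite unfold_in => /eqP rz.
by rewrite !inE /node_of xpair_eqE eqxx rz orbN.
Qed.

(** An edge leaving the component belongs to the other class, so its inner end is a port. With fewer
    than two ports, deleting them would cut a remaining vertex of the component off from another
    component, against 2-connectedness. *)
Lemma two_ports (G : sgraph) (e : bool -> rel G) (p : bool * G) :
  (forall i, symmetric (e i)) ->
  (forall x y, adj x y = e true x y || e false x y) ->
  k_connected 2 G -> 2 <= #|roots (e p.1)| ->
  p \in nodes e -> 2 <= #|ports e p|.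
Proof.
case: p => i z syme adjE [_ conn] /= roots2 zN; rewrite leqNgt; apply/negP=> lt2.
have e_adj j x y : e j x y -> adj x y by rewrite adjE; case: j => ->; rewrite ?orbT.
have := zN; rewrite inE /= => /andP[rz tz]; have /eqP rzE := rz.
have [y ry yz] : exists2 y, roots (e i) y & y != z.
  move: roots2; rewrite (cardD1x rz) => /card_gt0P[y /andP[ry yz]].
  by exists y.
have yK : y \notin component e (i, z).
  by rewrite inE /node_of xpair_eqE eqxx /= (eqP (ry : root (e i) y == y)).
have sPK : ports e (i, z) \subset component e (i, z).
  by apply/subsetP=> v; rewrite !inE => /andP[_].
(* A nontrivial component contains [z] and a neighbour of it, which are not both ports. *)
have [x xK xP] : exists2 x, x \in component e (i, z) & x \notin ports e (i, z).
  move: tz; rewrite inE => /existsP[w ezw].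
  have zw : z != w.
    by apply: contraTneq ezw => <-; apply/negP=> /e_adj; rewrite adj_irrefl.
  have sK : [set z; w] \subset component e (i, z).
    rewrite subUset !sub1set !inE /node_of !xpair_eqE eqxx /= rzE eqxx /=.
    rewrite -(rootP (sym_connect_sym (syme i)) (connect1 ezw)) rzE //.
  have /subsetPn[x xK xP] : ~~ ([set z; w] \subset ports e (i, z)).
    by apply: contraL lt2 => /subset_leq_card; rewrite cards2 zw -leqNgt.
  by exists x => //; apply: (subsetP sK).
have yP : y \notin ports e (i, z) by apply: contra yK; apply/subsetP.
have [u [v [/and3P[uv uP _] uK vK]]] :=
  crossing_edge (conn _ lt2 x y xP yP) xK yK.
have uz : node_of e u i = (i, z) by move: uK; rewrite inE => /eqP.
have tu : u \in touched (e i) by apply: nodes_touched => //; rewrite uz.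
have Neuv : ~~ e i u v.
  apply: contra vK => euv; rewrite inE -uz /node_of xpair_eqE eqxx /=.
  by rewrite (rootP (sym_connect_sym (syme i)) (connect1 euv)).
have tu' : u \in touched (e (~~ i)).
  rewrite inE; apply/existsP; exists v; move: uv Neuv; rewrite adjE.
  by case: (i) => /= /orP[] // ->.
move/negP: uP; apply; rewrite inE uz eqxx andbT inE.
by move: tu tu'; case: (i) => /= -> ->.
Qed.

Lemma small_separator (G : sgraph) (e : bool -> rel G) (m k : nat) :
  (forall i, symmetric (e i)) ->
  (forall x y, adj x y = e true x y || e false x y) ->
  k_connected 2 G ->
  (forall i, 2 <= #|roots (e i)|) ->
  (forall i, #|G| + 1 <= #|roots (e i)| + k) ->
  0 < m <= #|G| ->
  exists A F : {set G}, [/\ m <= #|A| < m + k, F \subset A,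
    #|F| + 2 * (#|roots (e true)| + #|roots (e false)|) <= 2 * #|G| + 2
    & forall u v, adj u v -> u \in A -> v \notin A -> u \in F].
Proof.
move=> syme adjE conn2 roots2 roots_k mG.
have [G2 conn] := conn2.
have connG x y : connect [rel u v | e true u v || e false u v] x y.
  apply: connect_sub (conn set0 _ x y _ _); rewrite ?cards0 ?inE // => u v.
  by rewrite /= adjE => /andP[uv _]; apply: connect1.
have tch v : (v \in touched (e true)) || (v \in touched (e false)).
  have [w] : exists w, w != v.
    move: G2; rewrite (cardD1 v) inE ltnS => /ltnW /card_gt0P[w].
    by rewrite !inE andbT; exists w.
  move=> wv; have /connectP[[|y p] /=] := connG v w.
    by move=> _ wE; rewrite wE eqxx in wv.
  case/andP=> /orP[] evy _ _; rewrite !inE; apply/orP; [left|right];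
    by apply/existsP; exists y.
have nodes0 : nodes e != set0.
  have /card_gt0P[v _] : 0 < #|G| by apply: leq_ltn_trans G2.
  apply/set0Pn; case/orP: (tch v) => tv.
    by exists (node_of e v true); apply: node_of_nodes.
  by exists (node_of e v false); apply: node_of_nodes.
have comp_k p : p \in nodes e -> #|component e p| <= k.
  move/card_component => le_p; have := leq_trans le_p (roots_k p.1).
  by rewrite addnC leq_add2l.
have [X [sX mX Xm FX]] := grow_nodes syme connG nodes0
  (fun p => two_ports syme adjE conn2 (roots2 p.1)) comp_k mG.
exists (covered e X), (frontier e X); split.
- by rewrite mX Xm.
- by apply/subsetP=> v; rewrite !inE => /andP[_]; case: (node_of e v true \in X).
(* [card_nodes] turns shared vertices minus nodes into vertices minus components. *)
- have arith F N S n c : F + 2 * N <= 2 * S + 2 -> N + n = c + S ->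
      F + 2 * c <= 2 * n + 2 by lia.
  exact: arith FX (card_nodes syme tch).
move=> u v; rewrite adjE => /orP[] euv uX vX;
  by case: (edge_out_cover syme sX euv uX vX).
Qed.

(** * Separators from nearly balanced colourings *)

Lemma leq_card_roots (T : finType) (e e' : rel T) :
  symmetric e -> symmetric e' ->
  (forall x y, connect e x y -> connect e' x y) -> #|roots e'| <= #|roots e|.
Proof.
move=> syme syme' sub; rewrite -(card_in_image (f := root e)).
  apply/subset_leq_card/subsetP=> _ /imageP[v _ ->].
  exact: roots_root (sym_connect_sym syme) _.
move=> u v /eqP ru /eqP rv /eqP; rewrite (root_connect (sym_connect_sym syme)).
by move/sub/(rootP (sym_connect_sym syme')); rewrite ru rv.
Qed.

Lemma connected_adj (G : sgraph) (k : nat) :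
  0 < k -> k_connected k G -> forall x y : G, connect (@adj G) x y.
Proof.
move=> k0 [_ conn] x y; apply: connect_sub (conn set0 _ x y _ _).
- by move=> u v /= /andP[uv _]; apply: connect1.
- by rewrite cards0.
- by rewrite inE.
by rewrite inE.
Qed.

Lemma ext_nbhd_setC (G : sgraph) (A F : {set G}) :
  (forall u v, adj u v -> u \in A -> v \notin A -> u \in F) ->
  ext_nbhd (~: A) \subset F.
Proof.
move=> bd; apply/subsetP=> v; rewrite !inE negbK => /andP[vA /existsP[u /andP[]]].
by rewrite inE => uA uv; apply: (bd v u); rewrite // adj_sym.
Qed.

Lemma ext_nbhd_setD (G : sgraph) (A F : {set G}) :
  (forall u v, adj u v -> u \in A -> v \notin A -> u \in F) ->
  ext_nbhd (A :\: F) \subset F.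
Proof.
move=> bd; apply/subsetP=> v; rewrite !inE => /andP[+ /existsP[u /andP[]]].
rewrite !inE negb_and negbK => /orP[// | vA] /andP[uF uA] uv.
by rewrite (bd u v) in uF.
Qed.

(** The hypothesis is that every tree has discrepancy below [s], cleared of denominators. A tree
    that contains a spanning forest of class [i] has few edges of that colour, so the forest is
    small. *)
Lemma colour_class_forests (G : sgraph) (r : nat) (f : {ffun edge G -> 'I_r})
    (s : nat) :
  (forall x y : G, connect (@adj G) x y) ->
  (forall S : {set edge G}, spanning_tree S ->
     r * \max_(i < r) #|(f @^-1: [set i]) :&: S| + 1 < #|G| + s) ->
  exists F : 'I_r -> {set edge G}, forall i,
    r * #|F i| + 1 < #|G| + s /\
    forall x y, connect (sub_adj (f @^-1: [set i])) x y ->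
      connect (sub_adj (F i)) x y.
Proof.
move=> connG balanced.
suff forest i : exists A : {set edge G}, r * #|A| + 1 < #|G| + s /\
    forall x y, connect (sub_adj (f @^-1: [set i])) x y -> connect (sub_adj A) x y.
  by have [F HF] := fin_all_exists forest; exists F.
have [S treeS subS] := spanning_tree_extending (f @^-1: [set i]) connG.
exists (S :&: f @^-1: [set i]); split=> //.
apply: leq_ltn_trans (balanced S treeS).
rewrite leq_add2r leq_mul2l setIC.
by rewrite (leq_bigmax (F := fun i => #|(f @^-1: [set i]) :&: S|)) orbT.
Qed.

(** [a] bounds the rank of colour [j]; [b], the sum of the forest sizes over the other [r.-1]
    colours, bounds the rank of their union. *)
Lemma two_class_ranks (G : sgraph) (r : nat) (f : {ffun edge G -> 'I_r})
    (s : nat) (j : 'I_r) :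
  (forall x y : G, connect (@adj G) x y) ->
  (forall S : {set edge G}, spanning_tree S ->
     r * \max_(i < r) #|(f @^-1: [set i]) :&: S| + 1 < #|G| + s) ->
  exists a b, [/\ r * a + 2 <= #|G| + s, r * b + 2 * r.-1 <= r.-1 * (#|G| + s),
    #|G| <= a + #|roots (sub_adj (f @^-1: [set j]))|
    & #|G| <= b + #|roots (sub_adj (~: (f @^-1: [set j])))|].
Proof.
move=> connG /(colour_class_forests connG)[F HF].
exists #|F j|, (\sum_(i | i != j) #|F i|); split.
- by have [+ _] := HF j; rewrite addn1 addn2.
- have -> : r.-1 = #|[pred i : 'I_r | i != j]| by rewrite (cardC1 j) card_ord.
  rewrite big_distrr /= mulnC -!sum_nat_const -big_split /=.
  apply: leq_sum => i _.
  by have [+ _] := HF i; rewrite addn1 addn2.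
- apply: leq_trans (card_le_edges_comps (F j)) _; rewrite leq_add2l.
  by apply: leq_card_roots; [apply: sub_adj_sym | apply: sub_adj_sym | case: (HF j)].
pose F' := \bigcup_(i | i != j) F i.
have F'_le : #|F'| <= \sum_(i | i != j) #|F i|.
  apply: (big_ind2 (fun (A : {set edge G}) n => #|A| <= n)) => //; first by rewrite cards0.
  by move=> A m B n Am Bn; apply: leq_trans (leq_card_setU _ _) (leq_add Am Bn).
apply: leq_trans (card_le_edges_comps F') (leq_add F'_le _).
apply: leq_card_roots; try exact: sub_adj_sym.
apply: connect_sub => u v /sub_adjP[d]; rewrite !inE => dj duv.
have sF : F (f d) \subset F' by apply: bigcup_sup.
apply: (sub_adjS sF); apply: (HF (f d)).2; apply/connect1/sub_adjP.
by exists d; rewrite // !inE.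
Qed.

(** The two rank bounds add up to [r * (a + b + 2) <= r * (n + s)], which bounds [c1 + c2] from
    below. *)
Lemma separator_sizes (r n s a b c1 c2 : nat) :
  2 <= r -> 0 < s -> 8 * r * s <= n ->
  r * a + 2 <= n + s -> r * b + 2 * r.-1 <= r.-1 * (n + s) ->
  n <= a + c1 -> n <= b + c2 ->
  [/\ 2 <= c1, 2 <= c2, 2 * n + 4 <= 2 * (c1 + c2) + 2 * s
    & exists k, [/\ n + 1 <= c1 + k, n + 1 <= c2 + k & r * k <= r.-1 * (n + s)]].
Proof.
case: r => // q; rewrite ltnS => q0 s0 large /= Ha Hb Hc1 Hc2.
have qs : q * 1 <= q * s by rewrite leq_mul2l s0 orbT.
have qn : q * (8 * s) <= q * n by rewrite leq_mul2l; nia.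
have qn' : 1 * n <= q * n by rewrite leq_mul2r q0 orbT.
have qs' : 1 * s <= q * s by rewrite leq_mul2r q0 orbT.
split.
- have: q.+1 * n <= q.+1 * (a + c1) by rewrite leq_mul2l Hc1 orbT.
  by nia.
- have: q.+1 * n <= q.+1 * (b + c2) by rewrite leq_mul2l Hc2 orbT.
  by nia.
- have ab : q.+1 * (a + b + 2) <= q.+1 * (n + s) by lia.
  by rewrite leq_mul2l /= in ab; lia.
(* A component has at most one vertex more than the rank of its class. *)
by exists (maxn a b + 1); split; [lia | lia | case: (leqP a b); nia].
Qed.

(** Here [m] is [n / (2r)] rounded down. Since [a] is below [n/(2r) + (1 - 1/r)(n + s)] and
    [s <= n/(8r)], more than [n/(2r) - s] vertices stay outside; deleting fewer than [2s <= n/(4r)]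
    boundary vertices leaves enough inside. *)
Lemma separator_sides (r n s m k a ac d x : nat) :
  2 <= r -> 0 < s -> 8 * r * s <= n -> m * (2 * r) <= n -> n < m.+1 * (2 * r) ->
  r * k <= r.-1 * (n + s) -> m <= a -> a < m + k -> a + ac = n -> d + x = a ->
  x + 2 <= 2 * s -> n <= 8 * r * ac /\ n <= 8 * r * d.
Proof.
move=> r2 s0 large mle mgt rk ma amk aac dx xs.
split.
  have amk' : r * (a + 1) <= r * (m + k) by rewrite leq_mul2l addn1 amk orbT.
  have n_eq : r * (a + ac) = r * n by rewrite aac.
  by case: r r2 large mle mgt rk amk' n_eq => // q _ /=; lia.
have md : r * (m + 2) <= r * (d + 2 * s) by rewrite leq_mul2l; lia.
by lia.
Qed.

Lemma nearly_balanced_colouring_separator (G : sgraph) (r : nat)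
    (f : {ffun edge G -> 'I_r}) (s : nat) :
  2 <= r -> k_connected 2 G -> 0 < s -> 8 * r * s <= #|G| ->
  (forall S : {set edge G}, spanning_tree S ->
     r * \max_(i < r) #|(f @^-1: [set i]) :&: S| + 1 < #|G| + s) ->
  exists U : {set G}, [/\ 0 < #|U|, 2 * #|U| <= #|G|, #|ext_nbhd U| + 2 <= 2 * s
    & #|G| <= 8 * r * #|U|].
Proof.
move=> r2 conn2 s0 large balanced.
have connG := connected_adj (isT : 0 < 2) conn2.
pose j := Ordinal (ltnW r2); pose E := f @^-1: [set j].
have [a [b [Ha Hb Hc1 Hc2]]] := two_class_ranks j connG balanced.
pose e (i : bool) : rel G := sub_adj (if i then E else ~: E).
have syme i : symmetric (e i) by apply: sub_adj_sym.
have adjE x y : adj x y = e true x y || e false x y.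
  apply/idP/orP => [/adj_edge[d dxy] | [] /sub_adj_adj //].
  have [dE | dE] := boolP (d \in E); [left | right]; apply/sub_adjP; exists d => //.
  by rewrite inE.
have [c1_2 c2_2 c12 [k [k1 k2 rk]]] := separator_sizes r2 s0 large Ha Hb Hc1 Hc2.
have r0 : 0 < r by apply: ltnW.
pose m := #|G| %/ (2 * r).
have mle : m * (2 * r) <= #|G| := leq_trunc_div _ _.
have mgt : #|G| < m.+1 * (2 * r) by apply: ltn_ceil; rewrite muln_gt0.
have rs : r * 1 <= r * s by rewrite leq_mul2l s0 orbT.
have m0 : 0 < m by case: (posnP m) mgt => // ->; lia.
have roots2 i : 2 <= #|roots (e i)| by case: i; [exact: c1_2 | exact: c2_2].
have roots_k i : #|G| + 1 <= #|roots (e i)| + k by case: i; [exact: k1 | exact: k2].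
have mG : 0 < m <= #|G| by rewrite m0 (leq_trans _ mle) // leq_pmulr // muln_gt0.
have [A [F [/andP[mA Am] FA cF bd]]] :=
  small_separator syme adjE conn2 roots2 roots_k mG.
have F_le : #|F| + 2 <= 2 * s.
  have arith x n c t : x + 2 * c <= 2 * n + 2 -> 2 * n + 4 <= 2 * c + 2 * t ->
      x + 2 <= 2 * t by lia.
  exact: arith cF c12.
have cardAC : #|A| + #|~: A| = #|G| by rewrite cardsC.
have cardAD : #|A :\: F| + #|F| = #|A|.
  by rewrite -(cardsID F A) (setIidPr FA) addnC.
have [big_setC big_setD] :=
  separator_sides r2 s0 large mle mgt rk mA Am cardAC cardAD F_le.
have pos (U : {set G}) : #|G| <= 8 * r * #|U| -> 0 < #|U|.
  by move=> GU; rewrite lt0n; apply/eqP=> U0; rewrite U0 in GU; lia.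
(* The complement serves if it has at most half of the vertices; otherwise [A], and with it
   [A :\: F], has less than half. *)
have [half | half] := leqP (2 * #|~: A|) #|G|.
  exists (~: A); split=> //; first exact: pos.
  by have := subset_leq_card (ext_nbhd_setC bd); lia.
exists (A :\: F); split=> //; [exact: pos | lia |].
by have := subset_leq_card (ext_nbhd_setD bd); lia.
Qed.

(** Nonnegativity of the discrepancy: at least [#|G| - 1] edges carry [r] colours, and the largest
    class is at least the average. *)
Lemma spanning_tree_edges_max (G : sgraph) (r : nat) (f : {ffun edge G -> 'I_r})
    (S : {set edge G}) :
  spanning_tree S ->
  #|G| <= r * \max_(i < r) #|(f @^-1: [set i]) :&: S| + 1.
Proof.
move=> [connS _]; apply: leq_trans (card_le_edges_comps S) _; apply: leq_add.
  rewrite -[in leqLHS]sum1_card (partition_big f xpredT) //=.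
  rewrite -[r in r * _]card_ord -sum_nat_const; apply: leq_sum => i _.
  rewrite sum1_card.
  rewrite (eq_card (B := mem ((f @^-1: [set i]) :&: S))) => [|d].
    exact: (leq_bigmax (F := fun i => #|(f @^-1: [set i]) :&: S|)).
  by rewrite !inE andbC.
apply/card_le1_eqP => x y; rewrite !unfold_in => /eqP rx /eqP ry.
by rewrite -rx -ry; apply/(rootP (sym_connect_sym (@sub_adj_sym _ _))).
Qed.

(** * Discrepancy and isoperimetric constant as real numbers *)

Local Open Scope ring_scope.

Lemma tree_discrepancyE (R : realType) (r : nat) (G : sgraph)
    (f : {ffun edge G -> 'I_r}) (S : {set edge G}) : (0 < r)%N ->
  tree_discrepancy R f S =
    (r * \max_(i < r) #|(f @^-1: [set i]) :&: S| + 1)%N%:R - #|G|%:R.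
Proof.
move=> r0; rewrite /tree_discrepancy mulrBr mulrCA mulfV ?pnatr_eq0 -?lt0n //.
by rewrite natrD natrM mulr1 opprB addrA.
Qed.

Lemma discrepancy_ge (R : realType) (r : nat) (G : sgraph) (x : R) :
  (0 < r)%N ->
  (forall f : {ffun edge G -> 'I_r}, exists2 S : {set edge G},
     spanning_tree S & x <= tree_discrepancy R f S) ->
  x <= discrepancy R r G.
Proof.
case: r => // r _ large; apply: lb_le_inf.
  (* The constant colouring makes the set under [inf] nonempty. *)
  by exists (sup [set tree_discrepancy R [ffun=> ord0 : 'I_r.+1] S
                 | S in @spanning_tree G]%classic); exists [ffun=> ord0].
move=> _ [f _ <-]; have [S treeS xS] := large f.
apply: le_trans xS _; apply: ub_le_sup; last by exists S.
(* A crude upper bound, so that the [sup] is a genuine one. *)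
exists (\sum_(S : {set edge G}) `|tree_discrepancy R f S|) => _ [S' _ <-].
rewrite (bigD1 S') //=; apply: le_trans (ler_norm _) _.
by rewrite lerDl; apply: sumr_ge0.
Qed.

Lemma isoperimetric_le (R : realType) (G : sgraph) (U : {set G}) :
  (0 < #|U|)%N -> (2 * #|U| <= #|G|)%N ->
  isoperimetric R G <= #|ext_nbhd U|%:R / #|U|%:R.
Proof.
move=> U0 UG; apply: ge_inf; last by exists U.
by exists 0 => _ [V _ <-]; apply: divr_ge0.
Qed.

(** A set of [h] vertices, half of them rounded down, has at most [h + 1 <= 2h] external neighbours.
    This keeps the claimed bound small compared with [#|G|]. *)
Lemma isoperimetric_le2 (R : realType) (G : sgraph) :
  (1 < #|G|)%N -> isoperimetric R G <= 2.
Proof.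
move=> G1.
have [h [h0 h_le h_ge]] : exists h, [/\ 0 < h, 2 * h <= #|G| & #|G| <= 2 * h + 1]%N.
  by exists (#|G| %/ 2)%N; split; lia.
pose U := [set x in take h (enum G)].
have cU : #|U| = h.
  rewrite cardsE (card_uniqP (take_uniq _ (enum_uniq _))) size_takel // -cardE.
  by apply: leq_trans h_le; rewrite leq_pmull.
apply: le_trans (isoperimetric_le R (U := U) _ _) _; rewrite ?cU //.
rewrite ler_pdivrMr ?ltr0n // -natrM ler_nat.
have nbhd_le : (#|ext_nbhd U| <= #|~: U|)%N.
  by apply/subset_leq_card/subsetP=> v; rewrite !inE => /andP[].
apply: leq_trans nbhd_le _; rewrite -(leq_add2l #|U|) cardsC cU.
by apply: leq_trans h_ge _; lia.
Qed.

Theorem corollary1p3 (R : realType) (r : nat) (hr : (2 <= r)%N) :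
  exists C : R, 0 < C /\
    forall G : sgraph,
      k_connected 3 G \/
      (k_connected 2 G /\
       C * (Num.sqrt #|G|%:R)^-1 <= isoperimetric R G) ->
      (Num.floor (isoperimetric R G * #|G|%:R / C))%:~R <= discrepancy R r G.
Proof.
have r0 : (0 < r)%N by apply: ltnW.
(* 16 is 8 times 2: the set [U] found below has [n <= 8 r |U|] and [|N(U)| <= 2s - 2]. *)
exists (16 * r)%N%:R; split=> [|G conn]; first by rewrite ltr0n muln_gt0.
have conn2 : k_connected 2 G.
  case: conn => [[G3 conn3] | [] //]; split; first exact: ltnW.
  by move=> X X2; apply: conn3; apply: ltnW.
have G2 : (2 < #|G|)%N by case: conn2.
have connG := connected_adj (isT : (0 < 2)%N) conn2.
set iota := isoperimetric R G; set C := (16 * r)%N%:R.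
have C0 : 0 < C :> R by rewrite ltr0n muln_gt0.
have := floor_le_tmp (iota * #|G|%:R / C).
(* A negative floor comes first: it lies below the nonnegative discrepancy of any spanning tree. *)
case: (Num.floor _) => s /= s_le; last first.
  apply: discrepancy_ge => // f.
  have [S treeS _] := spanning_tree_extending set0 connG.
  exists S => //; rewrite tree_discrepancyE //; apply: (@le_trans _ _ 0).
    by rewrite lerz0.
  by rewrite subr_ge0 ler_nat spanning_tree_edges_max.
apply: discrepancy_ge => // f; apply: contrapT => noS.
have balanced (S : {set edge G}) : spanning_tree S ->
    (r * \max_(i < r) #|(f @^-1: [set i]) :&: S| + 1 < #|G| + s)%N.
  move=> treeS; rewrite ltnNge; apply/negP=> big; apply: noS; exists S => //.
  by rewrite tree_discrepancyE // lerBrDr -[s%:~R]/(s%:R) -natrD ler_nat addnC.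
(* [s = 0] would contradict the nonnegativity of the discrepancy. *)
have s0 : (0 < s)%N.
  have [S treeS _] := spanning_tree_extending set0 connG.
  by have := spanning_tree_edges_max f treeS; have := balanced S treeS; lia.
move: s_le; rewrite -[s%:~R]/(s%:R) ler_pdivlMr // => s_le.
(* From [iota <= 2]: [16 r s <= iota n <= 2 n]. *)
have large : (8 * r * s <= #|G|)%N.
  have : s%:R * C <= 2 * #|G|%:R.
    by apply: le_trans s_le _; rewrite ler_wpM2r // isoperimetric_le2 // ltnW.
  by rewrite -!natrM ler_nat; lia.
have [U [U0 U2 NU GU]] :=
  nearly_balanced_colouring_separator hr conn2 s0 large balanced.
have := isoperimetric_le R U0 U2; rewrite ler_pdivlMr ?ltr0n // -/iota => iU.
have iota0 : 0 <= iota.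
  have : 0 <= iota * #|G|%:R by apply: le_trans s_le; rewrite -natrM.
  by rewrite pmulr_lge0 // ltr0n; lia.
(* The contradiction: [16 r s <= iota n <= 8 r iota |U| <= 8 r |N(U)| <= 16 r (s - 1)]. *)
have : iota * #|G|%:R <= iota * (8 * r * #|U|)%N%:R.
  by rewrite ler_wpM2l // ler_nat.
have : iota * (8 * r * #|U|)%N%:R <= (8 * r * #|ext_nbhd U|)%N%:R.
  by rewrite natrM mulrCA [leRHS]natrM ler_wpM2l.
move=> le1 le2; have := le_trans s_le (le_trans le2 le1).
rewrite -natrM ler_nat.
have: (r * (#|ext_nbhd U| + 2) <= r * (2 * s))%N by rewrite leq_mul2l NU orbT.
lia.
Qed.
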